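(* Let $f:[0,\infty)\to\mathbb{R}$ be a convex function with $f(0)\le 0$. Then $f\in\mathcal{W}$.
   Context: $\mathcal{W}$ denotes the class of all functions $f:[0,\infty)\to\mathbb{R}$ such that $f(x)-f(y)\ge f(x-y)$ for all $x\ge y\ge 0$; equivalently, $f(x+y)\ge f(x)+f(y)$ for all $x\ge y\ge 0$. *)

(* Defs.v *)
From HB Require Import structures.
From mathcomp Require Import all_boot all_order all_algebra.
From mathcomp Require Import all_classical all_reals all_analysis.

Set Implicit Arguments.
Unset Strict Implicit.
Unset Printing Implicit Defensive.

Import Order.TTheory GRing.Theory Num.Theory.

Local Open Scope classical_set_scope.
Local Open Scope ring_scope.

(* A function [0, +oo) -> R is represented by a total function R -> R whose
   values at negative arguments are irrelevant: classW only evaluates f on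
   [0, +oo), since y <= x makes x - y nonnegative. *)
Definition classW (R : realType) : set (R -> R) :=
  [set f | forall x y : R, 0 <= y -> y <= x -> f x - f y >= f (x - y)].

(* Main.v *)
Require Import Defs.
From HB Require Import structures.
From mathcomp Require Import all_boot all_order all_algebra.
From mathcomp Require Import all_classical all_reals all_analysis.
From mathcomp Require Import lra.

Import Order.TTheory GRing.Theory Num.Theory.

Local Open Scope classical_set_scope.
Local Open Scope ring_scope.

(** A convex function with [f 0 <= 0] is star-shaped: on the segment from [0]
    to [x] its graph lies below the chord, whose end over [0] is at height
    [f 0 <= 0], so [f (t * x) <= t * f x] for [0 <= t <= 1]
    ([convex_starshaped]).  When [0 <= y <= x] and [0 < x], the points [y] and
    [x - y] are the fractions [t = y / x] and [1 - t] of [x], and adding the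
    two bounds gives [f y + f (x - y) <= f x], the inequality that defines the
    class.  When [x = 0], it is [f 0 <= 0]. *)

(** This is the convexity inequality between [x] and [0] with weights [t] and
    [1 - t]: the term [(1 - t) * f 0] is nonpositive. *)
Lemma convex_starshaped (R : numFieldType) (E : lmodType R)
    (D : set E) (f : E -> R) (t : R) (x : E) :
  convex_function D f -> 0 \in D -> f 0 <= 0 -> x \in D -> 0 <= t <= 1 ->
  f (t *: x) <= t * f x.
Proof.
move=> f_convex D0 f0 Dx /andP[t0 t1].
have : f (t *: x + (1 - t) *: 0) <= t * f x + (1 - t) * f 0.
  exact: f_convex (Itv01 t0 t1) x 0 Dx D0.
rewrite scaler0 addr0 => /le_trans; apply.
by rewrite gerDl mulr_ge0_le0 // subr_ge0.
Qed.

Theorem theorem2p15 (R : realType) (f : R -> R)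
  (f_convex : convex_function (`[0, +oo[%classic : set R) f)
  (f0 : f 0 <= 0) :
  f \in @classW R.
Proof.
rewrite inE => x y y0 yx.
have := le_trans y0 yx; rewrite le_eqVlt => /predU1P[x_eq0|x_gt0].
  have -> : y = 0 by apply/le_anti; rewrite y0 x_eq0 yx.
  by rewrite -x_eq0 subr0 subrr.
have itvP (z : R) : 0 <= z -> z \in (`[0, +oo[%classic : set R).
  by rewrite inE /= in_itv /= andbT.
have star (t : R) : 0 <= t <= 1 -> f (t * x) <= t * f x.
  exact: (@convex_starshaped R R^o _ f t x f_convex
    (itvP 0 (lexx 0)) f0 (itvP x (ltW x_gt0))).
have t01 : 0 <= y / x <= 1.
  by rewrite divr_ge0 ?(ltW x_gt0) // ler_pdivrMr // mul1r.
have onem_t01 : 0 <= 1 - y / x <= 1 by lra.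
have := star _ t01; have := star _ onem_t01.
rewrite mulrBl mul1r divfK ?gt_eqF //; lra.
Qed.
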